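(* Consider algorithm TRIEST-FD (described in the context) run with integer parameter $M\ge 6$ on a fully-dynamic edge stream. Let $t^*$ be the first time step $t\ge M+1$ such that $|E^{(t)}|=M+1$ ($t^*=+\infty$ if no such time step exists). Then $\rho^{(t)}=|\Delta^{(t)}|$ for all $t<t^*$, and $\mathbb{E}\left[\rho^{(t)}\right]=|\Delta^{(t)}|$ for all $t\ge t^*$.
   Context: A fully-dynamic edge stream: at each time step $t=1,2,\dots$ an element $(\bullet,\{u,v\})$ arrives with $\bullet\in\{+,-\}$ and $u\neq v$; starting from the empty graph, $E^{(t)}=E^{(t-1)}\cup\{\{u,v\}\}$ if $\bullet=+$ and $E^{(t)}=E^{(t-1)}\setminus\{\{u,v\}\}$ if $\bullet=-$, and every operation has effect (an insertion is only of an edge not in $E^{(t-1)}$, a deletion only of an edge in $E^{(t-1)}$); the order is arbitrary but independent of the algorithm's random bits. $G^{(t)}$ is the graph with edge set $E^{(t)}$, $s^{(t)}=|E^{(t)}|$, and $\Delta^{(t)}$ the set of triangles of $G^{(t)}$ (sets of three edges $\{\{u,v\},\{v,w\},\{w,u\}\}\subseteq E^{(t)}$ with $u,v,w$ distinct). TRIEST-FD (random pairing) keeps an edge sample $\mathcal{S}$ (initially empty), counters $d_{\mathrm i}=d_{\mathrm o}=0$, and a counter $\tau$ which, by incremental updates after each insertion into or removal from $\mathcal{S}$, always equals the number of triangles all of whose edges are in $\mathcal{S}$. On a deletion of edge $e$: if $e\in\mathcal{S}$, $e$ is removed from $\mathcal{S}$ and $d_{\mathrm i}$ is increased by $1$;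 otherwise $d_{\mathrm o}$ is increased by $1$. On an insertion of edge $e$: if $d_{\mathrm i}+d_{\mathrm o}=0$, then if $|\mathcal{S}|<M$, $e$ is inserted into $\mathcal{S}$; otherwise, with probability $M/s^{(t)}$, an edge chosen uniformly at random from $\mathcal{S}$ is removed and $e$ inserted, else $\mathcal{S}$ is unchanged. If $d_{\mathrm i}+d_{\mathrm o}>0$, then with probability $d_{\mathrm i}/(d_{\mathrm i}+d_{\mathrm o})$, $e$ is inserted into $\mathcal{S}$ and $d_{\mathrm i}$ is decreased by $1$; otherwise $e$ is not inserted and $d_{\mathrm o}$ is decreased by $1$. Let $M^{(t)}=|\mathcal{S}|$, $\tau^{(t)}$, $d_{\mathrm i}^{(t)}$, $d_{\mathrm o}^{(t)}$ be the values at the end of time step $t$, $\omega^{(t)}=\min\{M,s^{(t)}+d_{\mathrm i}^{(t)}+d_{\mathrm o}^{(t)}\}$, and \[ \kappa^{(t)}=1-\sum_{j=0}^{2}\binom{s^{(t)}}{j}\binom{d_{\mathrm i}^{(t)}+d_{\mathrm o}^{(t)}}{\omega^{(t)}-j}\Big/\binom{s^{(t)}+d_{\mathrm i}^{(t)}+d_{\mathrm o}^{(t)}}{\omega^{(t)}} \] (with $\binom{0}{0}=1$). For $a\le b\le c$, $\psi_{a,b,c}=\binom{c}{b}/\binom{c-a}{b-a}=\prod_{i=0}^{a-1}\frac{c-i}{b-i}$. The estimate is $\rho^{(t)}=0$ if $M^{(t)}<3$ and $\rho^{(t)}=\frac{\tau^{(t)}}{\kappa^{(t)}}\psi_{3,M^{(t)},s^{(t)}}$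 otherwise. *)

(* Defs.v *)
(* Discrete probability over the algorithm's random bits is
   modelled by explicit finite distributions: lists of (probability, state). *)
From mathcomp Require Import all_boot all_order all_algebra.
Import GRing.Theory Num.Theory.

Set Implicit Arguments.
Unset Strict Implicit.
Unset Printing Implicit Defensive.

(* Vertices are natural numbers; an (undirected) edge {u,v} is stored
   normalized as (min u v, max u v). *)
Definition edge := (nat * nat)%type.
Definition norm_edge (u v : nat) : edge := (minn u v, maxn u v).

(* A stream element (b, (u, v)): b = true means '+', b = false means '-'. *)
Definition op := (bool * (nat * nat))%type.
Definition op_edge (o : op) : edge := norm_edge o.2.1 o.2.2.

Definition apply_op (o : op) (E : seq edge) : seq edge :=
  if o.1 then rcons E (op_edge o) else rem (op_edge o) E.

(* The stream is str : nat -> op; the element arriving at time step t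
   (t = 1, 2, ...) is str (t - 1).  graph_at str t is E^(t). *)
Fixpoint graph_at (str : nat -> op) (t : nat) : seq edge :=
  match t with
  | 0 => [::]
  | t'.+1 => apply_op (str t') (graph_at str t')
  end.

Definition valid_stream (str : nat -> op) : Prop :=
  forall t : nat,
    (str t).2.1 != (str t).2.2 /\
    (if (str t).1 then op_edge (str t) \notin graph_at str t
     else op_edge (str t) \in graph_at str t).

Definition tri_count (E : seq edge) : nat :=
  let N := (\max_(e <- E) e.2).+1 in
  \sum_(u <- iota 0 N) \sum_(v <- iota 0 N) \sum_(w <- iota 0 N)
    nat_of_bool [&& (u < v)%N, (v < w)%N, (u, v) \in E, (v, w) \in E & (u, w) \in E].

Definition state := (seq edge * nat * nat)%type.
Definition samp (st : state) : seq edge := st.1.1.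
Definition d_in (st : state) : nat := st.1.2.
Definition d_out (st : state) : nat := st.2.

Local Open Scope ring_scope.

(* One step of TRIEST-FD on element o, with s = s^(t) (graph size after the
   operation); returns the distribution of the next state. *)
Definition step (M : nat) (o : op) (s : nat) (st : state) : seq (rat * state) :=
  let e := op_edge o in
  let S := samp st in
  let di := d_in st in
  let dout := d_out st in
  if o.1 then
    if (di + dout == 0)%N then
      if (size S < M)%N then [:: (1, (rcons S e, di, dout))]
      else (1 - M%:R / s%:R, st) ::
           [seq (M%:R / s%:R / (size S)%:R, (rcons (rem x S) e, di, dout)) | x <- S]
    else [:: ((di%:R / (di + dout)%:R), (rcons S e, di.-1, dout));
             ((dout%:R / (di + dout)%:R), (S, di, dout.-1))]
  else if e \in S then [:: (1, (rem e S, di.+1, dout))]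
       else [:: (1, (S, di, dout.+1))].

Fixpoint dist (M : nat) (str : nat -> op) (t : nat) : seq (rat * state) :=
  match t with
  | 0 => [:: (1, ([::], 0%N, 0%N))]
  | t'.+1 =>
      let s := size (graph_at str t'.+1) in
      flatten [seq [seq (x.1 * y.1, y.2) | y <- step M (str t') s x.2]
              | x <- dist M str t']
  end.

(* kappa^(t) with d = d_i + d_o, omega = min(M, s + d);
   binom(d, omega - j) is 0 when omega < j. *)
Definition kappa (M s di dout : nat) : rat :=
  let d := (di + dout)%N in
  let w := minn M (s + d) in
  1 - \sum_(j < 3)
        (('C(s, j) * (if (j <= w)%N then 'C(d, w - j) else 0))%N%:R
         / ('C(s + d, w))%:R).

Definition psi3 (b c : nat) : rat :=
  \prod_(i < 3) ((c%:R - (i : nat)%:R) / (b%:R - (i : nat)%:R)).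

Definition rho (M s : nat) (st : state) : rat :=
  if (size (samp st) < 3)%N then 0
  else (tri_count (samp st))%:R / kappa M s (d_in st) (d_out st)
       * psi3 (size (samp st)) s.

(* Main.v *)
Require Import Defs.
From mathcomp Require Import all_boot all_order all_algebra.
From mathcomp Require Import zify ring.
Import Order.TTheory GRing.Theory Num.Theory.
Local Open Scope ring_scope.

(* Let d = d_i + d_o, which evolves deterministically, s = |E|, n = s + d and
   w = min(M, n).  Random pairing keeps the following exact law: each subset A
   of the current edge set is the sample with probability C(d, w - |A|) / C(n, w),
   and then d_i = w - |A|.  In particular the sample contains at least three
   edges with probability kappa, by Vandermonde.  For a triangle T,
   P(T <= S, |S| = m) = C(s - 3, m - 3) C(d, w - m) / C(n, w), and multiplying
   by psi_{3,m,s} gives P(|S| = m), so every triangle contributes kappa / kappa = 1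
   to the expected estimate.  As long as n <= M, the sample is all of E and d_o = 0. *)

(** * Sums whose range extends past the support *)

Lemma big_iota_widen (R : Type) (idx : R) (op : Monoid.law idx) (m n : nat)
    (F : nat -> R) :
  (m <= n)%N -> (forall i, (m <= i)%N -> F i = idx) ->
  \big[op/idx]_(i <- iota 0 n) F i = \big[op/idx]_(i <- iota 0 m) F i.
Proof.
move=> le_mn F0; rewrite -(subnKC le_mn) iotaD big_cat /= [X in op _ X]big1_seq ?Monoid.mulm1 //.
by move=> i /andP[_]; rewrite mem_iota => /andP[/F0].
Qed.

Lemma big_ord_widen0 (R : Type) (idx : R) (op : Monoid.law idx) (m n : nat)
    (F : nat -> R) :
  (m <= n)%N -> (forall i, (m <= i)%N -> F i = idx) ->
  \big[op/idx]_(i < n) F i = \big[op/idx]_(i < m) F i.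
Proof.
by move=> le_mn F0; rewrite -!(big_mkord xpredT) /index_iota !subn0; apply: big_iota_widen.
Qed.

(** * Sums over all subsequences of a list *)

Section Subsequences.
Variable T : eqType.
Implicit Types (s A : seq T) (x : T).

(** For duplicate-free [s] each subset occurs exactly once, in the order of [s]. *)
Fixpoint subseqs s : seq (seq T) :=
  if s is x :: s' then subseqs s' ++ [seq x :: A | A <- subseqs s'] else [:: [::]].

Lemma mem_subseqs s A : A \in subseqs s -> subseq A s.
Proof.
elim: s A => [|x s IHs] A /=; first by rewrite inE => /eqP ->.
rewrite mem_cat => /orP[/IHs sAs | /mapP[B /IHs sBs ->]].
  exact: subseq_trans sAs (subseq_cons s x).
by rewrite /= eqxx.
Qed.

Lemma sum_subseqs_cons x s (f : seq T -> rat) :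
  \sum_(A <- subseqs (x :: s)) f A
    = \sum_(A <- subseqs s) f A + \sum_(A <- subseqs s) f (x :: A).
Proof. by rewrite /= big_cat big_map. Qed.

Lemma sum_subseqs_rcons x s (f : seq T -> rat) :
  \sum_(A <- subseqs (rcons s x)) f A
    = \sum_(A <- subseqs s) f A + \sum_(A <- subseqs s) f (rcons A x).
Proof.
elim: s f => [|y s IHs] f; first by rewrite /= !big_cons !big_nil; ring.
by rewrite rcons_cons !sum_subseqs_cons !IHs; ring.
Qed.

(** Without repetitions in [s], sending [A] to the pair of [rem x A] and the bit [x \in A] is a
    bijection from the subsequences of [s] to the pairs of a subsequence of [rem x s] and a bit. *)
Lemma sum_subseqs_rem x s (g : seq T -> bool -> rat) :
  uniq s -> x \in s ->
  \sum_(A <- subseqs s) g (rem x A) (x \in A)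
    = \sum_(B <- subseqs (rem x s)) (g B false + g B true).
Proof.
elim: s g => [//|y s IHs] g /= /andP[ys us]; rewrite inE sum_subseqs_cons /=.
have [-> _ | nxy /= xs] := eqVneq x y.
  rewrite big_split /=; congr (_ + _).
    apply: eq_big_seq => A /mem_subseqs /mem_subseq sA.
    have xA : y \notin A by apply: contra ys => /sA.
    by rewrite rem_id // (negPf xA).
  by apply: eq_bigr => A _; rewrite inE eqxx.
rewrite big_cat big_map IHs //; congr (_ + _).
rewrite -(IHs (fun B => g (y :: B))) //.
by apply: eq_bigr => A _; rewrite inE (negPf nxy).
Qed.

(* Each B of size k is reached from the size s - k sets A = B + x. *)
Lemma sum_subseqs_drop1 s (g : seq T -> rat) (k : nat) :
  uniq s ->
  \sum_(A <- subseqs s | size A == k.+1) \sum_(x <- A) g (rem x A)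
    = ((size s)%:R - k%:R) * \sum_(B <- subseqs s | size B == k) g B.
Proof.
elim: s g k => [|y s IHs] g k.
  by rewrite /= !big_cons !big_nil; case: k => [|k] _ /=; ring.
move=> /andP[ys us]; rewrite /= !big_cat !big_map /= IHs //.
have -> : \sum_(A <- subseqs s | (size A).+1 == k.+1)
    \sum_(x <- y :: A) g (rem x (y :: A))
  = \sum_(A <- subseqs s | size A == k) g A
    + \sum_(A <- subseqs s | size A == k) \sum_(x <- A) g (y :: rem x A).
  rewrite -big_split big_seq_cond [RHS]big_seq_cond; apply: eq_bigr => A.
  case/andP=> /mem_subseqs /mem_subseq sA _; rewrite big_cons /= eqxx.
  congr (_ + _); apply: eq_big_seq => x xA /=.
  by case: eqP => // yx; rewrite yx sA in ys.
case: k => [|k].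
  rewrite [X in _ + (_ + X)]big1 => [|A /eqP/size0nil ->]; last by rewrite big_nil.
  rewrite [X in _ = _ * (_ + X)]big_pred0 //; rewrite -natr1; ring.
by rewrite (IHs (fun B => g (y :: B))) // -!natr1; ring.
Qed.

Lemma sum_subseqs_size s (h : nat -> rat) :
  \sum_(A <- subseqs s) h (size A) = \sum_(m < (size s).+1) 'C(size s, m)%:R * h m.
Proof.
elim: s h => [|x s IHs] h.
  by rewrite /= big_cons big_nil big_ord1 bin0; ring.
rewrite sum_subseqs_cons IHs /= (IHs (fun m => h m.+1)) [RHS]big_ord_recl.
rewrite [X in X + _]big_ord_recl !bin0 -addrA; congr (_ + _).
under [X in _ = X]eq_bigr => m _ do rewrite lift0 binS natrD mulrDl.
rewrite big_split /=; congr (_ + _).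
by rewrite [RHS]big_ord_recr /= bin_small // mul0r addr0.
Qed.

(** Removing [t] matches the subsequences that contain [t] with all subsequences of the rest; the
    induction removes one element of [t] at a time and shifts [h] by one. *)
Lemma sum_subseqs_containing s (t : seq T) (h : nat -> rat) :
  uniq s -> uniq t -> {subset t <= s} ->
  \sum_(A <- subseqs s) h (size A) * (all (mem A) t)%:R
    = \sum_(m < (size s - size t).+1) 'C(size s - size t, m)%:R * h (size t + m)%N.
Proof.
elim: t s h => [|x t IHt] s h us.
  move=> _ _; rewrite subn0 -sum_subseqs_size.
  by apply: eq_bigr => A _; rewrite mulr1.
move=> /andP[xt ut] ts; have xs : x \in s by rewrite ts ?mem_head.
pose g (B : seq T) (b : bool) := h (size B + b)%N * (b && all (mem B) t)%:R.
rewrite (eq_big_seq (fun A => g (rem x A) (x \in A))) => [|A /mem_subseqs sA].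
  rewrite sum_subseqs_rem //.
  rewrite (eq_bigr (fun B => (fun m => h m.+1) (size B) * (all (mem B) t)%:R)) => [|B _].
    rewrite (IHt (rem x s) (fun m => h m.+1)) ?rem_uniq //.
      suff -> : (size (rem x s) - size t = size s - size (x :: t))%N by [].
      by rewrite size_rem //= -subn1 -subnDA.
    move=> y yt; rewrite mem_rem_uniq // inE ts ?inE ?yt ?orbT // andbT.
    by apply: contraNneq xt => <-.
  by rewrite /g mulr0 add0r addn1.
rewrite /g /=; have [xA /=|xA] := boolP (x \in A); last by rewrite !mulr0.
rewrite size_rem // addn1 prednK; last by case: (A) xA.
congr (_ * (nat_of_bool _)%:R); apply: eq_in_all => y yt /=.
rewrite mem_rem_uniq ?(subseq_uniq sA) // inE.
by have /negPf -> : y != x by apply: contraNneq xt => <-.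
Qed.

End Subsequences.

(** * Recurrences for the hypergeometric weights *)

(* The probability that the sample is a given set of size a. *)
Definition hyper (d n w a : nat) : rat :=
  (if (a <= w)%N then 'C(d, w - a) else 0)%N%:R / 'C(n, w)%:R.

Lemma hyper_neq0 d n w a : hyper d n w a != 0 -> (a <= w)%N /\ (w - a <= d)%N.
Proof.
rewrite /hyper; case: leqP => [aw|_]; last by rewrite mul0r eqxx.
by case: (leqP (w - a) d) => [//|dwa]; rewrite bin_small // mul0r eqxx.
Qed.

(** Pascal's rule: after a deletion, a sample of size [a] comes either from itself or from itself
    with the deleted edge, while [n] and [w] are unchanged. *)
Lemma hyper_delete d n w a : hyper d.+1 n w a = hyper d n w a + hyper d n w a.+1.
Proof.
rewrite /hyper -mulrDl -natrD; congr (_%:R / _).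
case: ltngtP => [aw|//|->]; last by rewrite subnn !bin0.
by rewrite -(subnSK aw) binS.
Qed.

(** The factor is the probability d_o / d that the new edge stays out; the next lemma has its
    counterpart d_i / d. *)
Lemma hyper_insert_out d n w a : (0 < d)%N ->
  hyper d n w a * ((d - (w - a))%:R / d%:R) = hyper d.-1 n w a.
Proof.
case: d => // d _; rewrite /hyper /=; case: leqP => [aw|_]; last by rewrite !mul0r.
set k := (w - a)%N; have := mul_bin_down d.+1 k => /(congr1 (fun m => m%:R : rat)).
rewrite !natrM /= => E; have d0 : d.+1%:R != 0 :> rat by rewrite pnatr_eq0.
by rewrite mulrAC mulrA -[_ * _%:R]mulrC -E [d.+1%:R * _]mulrC mulfK.
Qed.

Lemma hyper_insert_in d n w a : (0 < d)%N ->
  hyper d n w a * ((w - a)%:R / d%:R) = hyper d.-1 n w a.+1.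
Proof.
case: d => // d _; rewrite /hyper /=; case: (ltngtP a w) => [aw|_|->].
- have := mul_bin_diag d.+1 (w - a.+1) => /(congr1 (fun m => m%:R : rat)).
  rewrite !natrM /= subnSK // => E.
  have d0 : d.+1%:R != 0 :> rat by rewrite pnatr_eq0.
  by rewrite mulrAC mulrA -[_ * _%:R]mulrC -E [d.+1%:R * _]mulrC mulfK.
- by rewrite !mul0r.
- by rewrite subnn mul0r mulr0 mul0r.
Qed.

Lemma hyper0 n w a : hyper 0 n w a = (a == w)%:R / 'C(n, w)%:R.
Proof.
by rewrite /hyper bin0n subn_eq0; case: ltngtP.
Qed.

(** * Exact law of the state, one operation at a time *)

Definition exp_dist (l : seq (rat * state)) (f : state -> rat) : rat :=
  \sum_(x <- l) x.1 * f x.2.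

Lemma exp_dist_step M str t f :
  exp_dist (dist M str t.+1) f
    = exp_dist (dist M str t)
        (fun st => exp_dist (step M (str t) (size (graph_at str t.+1)) st) f).
Proof.
rewrite /exp_dist /= big_flatten big_map; apply: eq_bigr => x _.
by rewrite big_map mulr_sumr; apply: eq_bigr => y _; rewrite /= mulrA.
Qed.

(** The sum d_i + d_o does not depend on the random bits. The truncated predecessor leaves 0 at 0,
    as for an insertion with nothing to compensate. *)
Fixpoint pending (str : nat -> op) (t : nat) : nat :=
  if t is t'.+1 then
    if (str t').1 then (pending str t').-1 else (pending str t').+1
  else 0.

Lemma graph_uniq str t : valid_stream str -> uniq (graph_at str t).
Proof.
move=> Hv; elim: t => //= t IHt; rewrite /apply_op; case: (Hv t) => _.
by case: (str t).1 => He; rewrite ?rcons_uniq ?He ?rem_uniq.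
Qed.

(* Deleted edges still occupy their places in the sample: |S| + d_i = w. *)
Definition state_of (d w : nat) (A : seq edge) : state :=
  (A, (w - size A)%N, (d - (w - size A))%N).

(* A sample is a subsequence of the edge list, order included, so no quotient
   by permutations is needed. *)
Definition pairing_law (M d : nat) (E : seq edge) (f : state -> rat) : rat :=
  let n := (size E + d)%N in let w := minn M n in
  \sum_(A <- subseqs _ E) hyper d n w (size A) * f (state_of d w A).

Lemma pairing_law_delete (M d : nat) (E : seq edge) (o : op) (f : state -> rat) :
  uniq E -> ~~ o.1 -> op_edge o \in E ->
  pairing_law M d E (fun st => exp_dist (step M o (size E).-1 st) f)
    = pairing_law M d.+1 (rem (op_edge o) E) f.
Proof.
move=> uE del; set e := op_edge o => eE.
have sE : (size (rem e E) + d.+1 = size E + d)%N.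
  by rewrite size_rem // addnS -addSn prednK //; case: (E) eE.
rewrite /pairing_law sE /=; set n := (size E + d)%N; set w := minn M n.
pose g (B : seq edge) (b : bool) := hyper d n w (size B + b) *
  f (if b then (B, (w - (size B).+1).+1, (d - (w - (size B).+1))%N)
     else (B, (w - size B)%N, (d - (w - size B)).+1)).
rewrite (eq_big_seq (fun A => g (rem e A) (e \in A))) => [|A /mem_subseqs sA].
  rewrite sum_subseqs_rem //; apply: eq_bigr => B _.
  rewrite /g hyper_delete addn0 addn1 mulrDl /state_of; congr (_ + _).
    (* The counters on the two sides agree only where truncated subtraction is exact; elsewhere the
       weight is zero. *)
    have [->|/hyper_neq0[aw wad]] := eqVneq (hyper d n w (size B)) 0.
      by rewrite !mul0r.
    by rewrite subSn.
  have [->|/hyper_neq0[aw wad]] := eqVneq (hyper d n w (size B).+1) 0.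
    by rewrite !mul0r.
  by rewrite -(subnSK aw) subSS.
rewrite /step /state_of /exp_dist (negPf del) /samp /d_in /d_out /= -/e /g.
case: ifPn => eA; rewrite big_cons big_nil /= addr0 mul1r.
  by rewrite size_rem // addn1 prednK //; case: (A) eA.
by rewrite addn0 rem_id.
Qed.

Lemma pairing_law_insert_paired (M d : nat) (E : seq edge) (o : op) (f : state -> rat) :
  o.1 -> (0 < d)%N ->
  pairing_law M d E (fun st => exp_dist (step M o (size E).+1 st) f)
    = pairing_law M d.-1 (rcons E (op_edge o)) f.
Proof.
move=> ins d_gt0; set e := op_edge o.
rewrite /pairing_law sum_subseqs_rcons size_rcons -big_split /=.
have -> : ((size E).+1 + d.-1 = size E + d)%N by rewrite addSnnS prednK.
set n := (size E + d)%N; set w := minn M n.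
apply: eq_bigr => A _; rewrite size_rcons.
rewrite -hyper_insert_in // -hyper_insert_out //.
have [->|/hyper_neq0[aw wad]] := eqVneq (hyper d n w (size A)) 0.
  by rewrite !mul0r addr0.
rewrite /state_of /step ins /samp /d_in /d_out /= subnKC // eqn0Ngt d_gt0 /=.
rewrite /exp_dist !big_cons big_nil /= -/e size_rcons addr0 mulrDr !mulrA addrC.
rewrite -(subnS w) -!subn1 -!subnDA addn1 add1n; congr (_ + _).
(* If [size A] is [w], then d_i = 0: the counters of the two sides differ, but this branch has
   probability 0. *)
have [lt_aw|] := ltnP (size A) w; first by rewrite subnSK.
by rewrite -subn_eq0 => /eqP ->; rewrite mulr0 !mul0r.
Qed.

(** Here [w] is the number of edges both before and after, so the law is concentrated on the full
    edge list. *)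
Lemma pairing_law_insert_fill (M : nat) (E : seq edge) (o : op) (f : state -> rat) :
  o.1 -> (size E < M)%N ->
  pairing_law M 0 E (fun st => exp_dist (step M o (size E).+1 st) f)
    = pairing_law M 0 (rcons E (op_edge o)) f.
Proof.
move=> ins ltEM; set e := op_edge o.
rewrite /pairing_law sum_subseqs_rcons size_rcons -big_split /= !addn0.
rewrite (minn_idPr ltEM) (minn_idPr (ltnW ltEM)).
apply: eq_big_seq => A /mem_subseqs/size_subseq leAE.
rewrite size_rcons !hyper0 (ltn_eqF (_ : size A < (size E).+1)%N) // !mul0r add0r eqSS !binn.
have [sA|] := eqVneq; last by rewrite !mul0r.
rewrite /state_of /step ins /samp /d_in /d_out /= sA subnn ltEM /=.
by rewrite /exp_dist big_cons big_nil /= size_rcons sA !subnn addr0 !mul1r.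
Qed.

(** With d = 0 the law is uniform on the subsets of size [M], and reservoir sampling keeps it
    uniform. A new sample containing [e] arises from each old sample that extends its other edges by
    one. *)
Lemma pairing_law_insert_reservoir (M : nat) (E : seq edge) (o : op) (f : state -> rat) :
  uniq E -> o.1 -> (0 < M)%N -> (M <= size E)%N ->
  pairing_law M 0 E (fun st => exp_dist (step M o (size E).+1 st) f)
    = pairing_law M 0 (rcons E (op_edge o)) f.
Proof.
case: M => // k uE ins _ leME; set M := k.+1 in leME *; set e := op_edge o; set n := size E.
rewrite /pairing_law sum_subseqs_rcons size_rcons /= !addn0 -/n.
rewrite (minn_idPl leME) (minn_idPl (leqW leME)).
pose F A := f (A, 0%N, 0%N).
have restrict (h : seq edge -> nat) m (G : seq edge -> rat) c : 
    \sum_(A <- subseqs _ E) (h A == m)%:R / c * G A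
    = c^-1 * \sum_(A <- subseqs _ E | h A == m) G A.
  rewrite [in RHS]big_mkcond mulr_sumr; apply: eq_bigr => A _.
  by case: eqP => _; rewrite ?mul1r // !mul0r mulr0.
under eq_bigr => A _ do rewrite hyper0.
under [in RHS]eq_bigr => A _ do rewrite hyper0.
under [X in _ = _ + X]eq_bigr => A _ do rewrite hyper0 size_rcons.
rewrite !restrict.
(* Each [x] is evicted with probability (M / (n+1)) / M = 1 / (n+1). *)
rewrite (eq_bigr (fun A => (1 - M%:R / n.+1%:R) * F A
    + (n.+1%:R)^-1 * \sum_(x <- A) F (rcons (rem x A) e))) => [|A /eqP sA]; last first.
  rewrite /state_of /step ins /samp /d_in /d_out /= sA subnn ltnn /=.
  rewrite /exp_dist big_cons big_map /=; congr (_ + _).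
  rewrite mulr_sumr; apply: eq_bigr => x _.
  have M0 : M%:R != 0 :> rat by rewrite pnatr_eq0.
  by rewrite [_ / _ / _]mulrAC mulfV // mul1r; congr (_ * f _).
rewrite big_split /= -!mulr_sumr (sum_subseqs_drop1 _ _ (fun B => F (rcons B e))) // -/n.
rewrite [in RHS](eq_bigr F) => [|A /eqP sA]; last by rewrite /state_of sA subnn.
rewrite [X in _ = _ + _ * X](eq_bigr (fun B => F (rcons B e))) => [|B /eqP sB]; last first.
  by rewrite /state_of size_rcons sB subnn.
rewrite [X in _ = _ + _ * X](eq_bigl (fun B => size B == k)) //.
(* Samples without and with [e] are now two opaque sums; on both sides their coefficient is (n - k)
   / ((n+1) C(n, M)). *)
move: (\sum_(_ <- _ | _) _) => X; move: (\sum_(_ <- _ | _) _) => Y.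
have N0 : n.+1%:R != 0 :> rat by rewrite pnatr_eq0.
have -> : 'C(n.+1, M)%:R^-1 = (n%:R - k%:R) / (n.+1%:R * 'C(n, M)%:R) :> rat.
  have := mul_bin_down n.+1 M => /(congr1 (fun m => m%:R : rat)).
  rewrite !natrM /= subSS natrB => [->|]; last exact: ltnW.
  have nk0 : n%:R - k%:R != 0 :> rat by rewrite -natrB ?pnatr_eq0 ?subn_eq0 -?ltnNge // ltnW.
  by rewrite invfM mulrA mulfV // mul1r.
have -> : 1 - M%:R / n.+1%:R = (n%:R - k%:R) / n.+1%:R :> rat.
  by rewrite -[X in X - _](mulfV N0) -mulrBl -!natr1; congr (_ / _); ring.
by rewrite invfM; ring.
Qed.

(** The test function is arbitrary so that the induction hypothesis applies to the one-step
    expectation of [f]. *)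
Lemma dist_pairing M str t f : (0 < M)%N -> valid_stream str ->
  exp_dist (dist M str t) f = pairing_law M (pending str t) (graph_at str t) f.
Proof.
move=> M_gt0 Hv; elim: t f => [|t IHt] f.
  by rewrite /exp_dist /pairing_law /= !big_cons !big_nil /hyper /= minn0 bin0 /state_of /= divr1.
rewrite exp_dist_step IHt /= {IHt}.
have uE := graph_uniq _ t Hv; case: (Hv t) => _.
rewrite /apply_op; case: ifPn => ins He.
  rewrite size_rcons; have [d0|] := posnP (pending str t); last first.
    by move=> d_gt0; apply: pairing_law_insert_paired.
  rewrite d0; case: (ltnP (size (graph_at str t)) M) => cmp.
    exact: pairing_law_insert_fill.
  by apply: pairing_law_insert_reservoir; rewrite // M_gt0.
by rewrite size_rem // pairing_law_delete.
Qed.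

(** * Counting triangles *)

Definition tri_edges (u v w : nat) : seq edge := [:: (u, v); (v, w); (u, w)].

Definition is_tri (E : seq edge) (u v w : nat) : bool :=
  [&& (u < v)%N, (v < w)%N & all (mem E) (tri_edges u v w)].

(** The vertex range in [tri_count] depends on the edge list. A common range for all samples is what
    permits exchanging the sum over samples with the sums over vertices. *)
Lemma tri_count_bound (E : seq edge) (N : nat) : {in E, forall e, e.2 < N}%N ->
  tri_count E
    = (\sum_(u <- iota 0 N) \sum_(v <- iota 0 N) \sum_(w <- iota 0 N) is_tri E u v w)%N.
Proof.
move=> EN; rewrite /tri_count; set N0 := (\max_(e <- E) e.2)%N.
have leN0 e : e \in E -> (e.2 <= N0)%N by move=> eE; apply: (@leq_bigmax_seq _ _ xpredT snd).
have isE u v w : is_tri E u v w = [&& u < v, v < w, (u, v) \in E, (v, w) \in E & (u, w) \in E]%N.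
  by rewrite /is_tri /= andbT.
have tri_lt u v w : is_tri E u v w -> [/\ u <= N0, v <= N0 & w <= N0]%N.
  by rewrite isE => /and5P[uv vw _ _ /leN0 /= wN]; split=> //; lia.
(* An empty list is treated apart: [tri_count] then still ranges over the vertex 0, while [N] may be
   0. *)
have [E0|[e eE]] : E = [::] \/ exists e, e \in E.
    by case: (E) => [|e s]; [left | right; exists e; rewrite mem_head].
  rewrite !big1 // => u _; rewrite big1 // => v _; rewrite big1 // => w _;
  by rewrite ?isE E0 !andbF.
have lt_N0N : (N0 < N)%N.
  have N_gt0 : (0 < N)%N by apply: leq_ltn_trans (EN e eE).
  rewrite -(prednK N_gt0) ltnS; apply/bigmax_leqP_seq => x xE _.
  by rewrite -ltnS prednK // EN.
have not_tri u v w : (N0 < u)%N || (N0 < v)%N || (N0 < w)%N -> nat_of_bool (is_tri E u v w) = 0%N.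
  by case: (boolP (is_tri E u v w)) => // /tri_lt[]; lia.
rewrite [RHS](@big_iota_widen _ _ _ N0.+1) // => [|u uN]; last first.
  by rewrite big1 // => v _; rewrite big1 // => w _; rewrite not_tri ?uN.
apply: eq_bigr => u _; rewrite [RHS](@big_iota_widen _ _ _ N0.+1) // => [|v vN]; last first.
  by rewrite big1 // => w _; rewrite not_tri ?vN ?orbT.
apply: eq_bigr => v _; rewrite [RHS](@big_iota_widen _ _ _ N0.+1) // => [|w wN]; last first.
  by rewrite not_tri ?wN ?orbT.
by apply: eq_bigr => w _; rewrite isE.
Qed.

Lemma tri_edges_uniq u v w : (u < v)%N -> (v < w)%N -> uniq (tri_edges u v w).
Proof. by move=> uv vw; rewrite /= !inE !xpair_eqE; lia. Qed.

Lemma is_tri_size (E : seq edge) u v w : is_tri E u v w -> (3 <= size E)%N.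
Proof.
case/and3P=> uv vw /allP sE.
by apply: (@uniq_leq_size _ (tri_edges u v w)); rewrite ?tri_edges_uniq.
Qed.

Lemma tri_count_small (E : seq edge) : (size E < 3)%N -> tri_count E = 0%N.
Proof.
move=> sE; pose N := (\max_(e <- E) e.2).+1%N.
rewrite (@tri_count_bound _ N) => [|e eE]; last first.
  by rewrite ltnS; apply: (@leq_bigmax_seq _ _ xpredT snd).
rewrite big1 // => u _; rewrite big1 // => v _; rewrite big1 // => w _.
by case: (boolP (is_tri E u v w)) => // /is_tri_size; rewrite leqNgt sE.
Qed.

(** * Total mass, [kappa] and [psi3] *)

Lemma sum_hyper s d w : (w <= s + d)%N ->
  \sum_(j < s.+1) 'C(s, j)%:R * hyper d (s + d) w j = 1.
Proof.
move=> wsd.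
pose F j := 'C(s, j)%:R * hyper d (s + d) w j : rat.
have F0 j : (s < j)%N -> F j = 0 by move=> sj; rewrite /F bin_small ?mul0r.
have F0' j : (w < j)%N -> F j = 0 by rewrite /F /hyper ltnNge => /negPf ->; rewrite mul0r mulr0.
(* Vandermonde sums up to [w], the goal up to [s]; a common longer range covers either order of the
   two. *)
rewrite -(@big_ord_widen0 _ _ _ s.+1 (s.+1 + w.+1) F) ?leq_addr //.
rewrite (@big_ord_widen0 _ _ _ w.+1 (s.+1 + w.+1) F) ?leq_addl //.
have -> : \sum_(j < w.+1) F j = (\sum_(j < w.+1) 'C(s, j) * 'C(d, w - j))%N%:R / 'C(s + d, w)%:R.
  rewrite natr_sum mulr_suml; apply: eq_bigr => j _.
  by rewrite /F /hyper -ltnS ltn_ord natrM mulrA.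
by rewrite binomial.Vandermonde divff // pnatr_eq0 -lt0n bin_gt0.
Qed.

(** By [sum_hyper], the complement of the mass on sizes 0, 1, 2 is the mass on sizes at least 3. *)
Lemma kappa_tail M s di dout : (3 <= s)%N -> let d := (di + dout)%N in
  let n := (s + d)%N in
  kappa M s di dout
    = \sum_(m < (s - 3).+1) 'C(s, 3 + m)%:R * hyper d n (minn M n) (3 + m)%N.
Proof.
move=> s3 d n; have := @sum_hyper s d (minn M n) (geq_minr _ _).
have -> : s.+1 = (3 + (s - 3).+1)%N by lia.
rewrite big_split_ord /= => sum1; rewrite /kappa -/d -/n -[X in X - _ = _]sum1.
set A := \sum_(i < 3) _; set B := \sum_(j < 3) _.
have -> : B = A by apply: eq_bigr => i _; rewrite /hyper natrM mulrA.
by rewrite [A + _]addrC addrK.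
Qed.

Lemma kappa_gt0 M s di dout : (3 <= M)%N -> (3 <= s)%N -> 0 < kappa M s di dout.
Proof.
move=> M3 s3; rewrite kappa_tail //; set d := (di + dout)%N.
set w := minn M (s + d).
have hyper_ge0 a : 0 <= hyper d (s + d) w a by rewrite /hyper divr_ge0 ?ler0n.
(* One positive term suffices: the one for the largest attainable sample size, [minn s w]. *)
have lt_i : (minn s w - 3 < (s - 3).+1)%N by lia.
rewrite (bigD1 (Ordinal lt_i)) //=; apply: ltr_wpDr.
  by apply: sumr_ge0 => i _; rewrite mulr_ge0 ?ler0n.
have -> : (3 + (minn s w - 3) = minn s w)%N by lia.
rewrite /hyper geq_minr mulr_gt0 ?divr_gt0 ?ltr0n ?bin_gt0 ?geq_minl ?geq_minr //.
by rewrite /w; lia.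
Qed.

(* [psi3] is the factor turning 'C(s - 3, m) into 'C(s, 3 + m). *)
Lemma psi3_bin s m : (3 <= s)%N ->
  'C(s - 3, m)%:R * psi3 (3 + m) s = 'C(s, 3 + m)%:R.
Proof.
case: s => [|[|[|s]]] // _; rewrite /psi3 !subSS subn0.
have E (n k : nat) : k.+1%:R * 'C(n.+1, k.+1)%:R = n.+1%:R * 'C(n, k)%:R :> rat.
  by rewrite -!natrM -mul_bin_diag.
have S (n k : nat) : 'C(n.+1, k.+1)%:R = n.+1%:R / k.+1%:R * 'C(n, k)%:R :> rat.
  by rewrite mulrAC -E mulrAC mulfV ?mul1r // pnatr_eq0.
have -> : (3 + m = m.+3)%N by [].
rewrite !S !big_ord_recl big_ord0 /= /bump /= !subr0 mulr1.
rewrite -!natrB // !subSS !subn0.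
by rewrite [LHS]mulrC -!mulrA.
Qed.

(** * Unbiasedness at every time step *)

Lemma expected_rho M str t : (3 <= M)%N -> valid_stream str ->
  exp_dist (dist M str t) (rho M (size (graph_at str t)))
    = (tri_count (graph_at str t))%:R.
Proof.
move=> M3 Hv; rewrite dist_pairing //; last exact: ltn_trans M3.
rewrite /pairing_law /=; have := graph_uniq _ t Hv; move: (graph_at str t) (pending str t).
move=> E d uE; set s := size E; set n := (s + d)%N; set w := minn M n.
have [s3|s3] := ltnP s 3.
  rewrite tri_count_small // big_seq big1 // => A /mem_subseqs/size_subseq sA.
  by rewrite /rho /= (leq_ltn_trans sA) ?mulr0.
pose K := \sum_(m < (s - 3).+1) 'C(s, 3 + m)%:R * hyper d n w (3 + m)%N.
(* Apart from the triangle count, the probability and the scaling depend on the sample only through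
   its size. *)
pose H a := hyper d n w a * (if (a < 3)%N then 0 else psi3 a s / K).
rewrite (eq_bigr (fun A => H (size A) * (tri_count A)%:R)) => [|A _]; last first.
  rewrite /H /rho /=.
  have [->|/hyper_neq0[aw wad]] := eqVneq (hyper d n w (size A)) 0.
    by rewrite !mul0r.
  case: ifP => _; first by rewrite mulr0 !mul0r.
  by rewrite kappa_tail // subnKC // -/n -/w -/K; ring.
pose N := (\max_(e <- E) e.2).+1%N.
have EN : {in E, forall e, e.2 < N}%N.
  by move=> e eE; rewrite ltnS; apply: (@leq_bigmax_seq _ _ xpredT snd).
rewrite (tri_count_bound _ _ EN).
rewrite (eq_big_seq (fun A => \sum_(u <- iota 0 N) \sum_(v <- iota 0 N) \sum_(x <- iota 0 N)
   H (size A) * (is_tri A u v x)%:R)) => [|A /mem_subseqs/mem_subseq sA]; last first.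
  rewrite (@tri_count_bound A N) => [|e /sA/EN //].
  rewrite natr_sum mulr_sumr; apply: eq_bigr => u _.
  rewrite natr_sum mulr_sumr; apply: eq_bigr => v _.
  by rewrite natr_sum mulr_sumr.
rewrite exchange_big natr_sum; apply: eq_bigr => u _.
rewrite exchange_big natr_sum; apply: eq_bigr => v _.
rewrite exchange_big natr_sum; apply: eq_bigr => x _ /=.
have [triE|ntriE] := boolP (is_tri E u v x); last first.
  rewrite big_seq big1 // => A /mem_subseqs/mem_subseq sA.
  case: (boolP (is_tri A u v x)) => [/and3P[uv vx /allP tA]|_]; last by rewrite mulr0.
  by case/negP: ntriE; rewrite /is_tri uv vx; apply/allP => e /tA /sA.
case/and3P: (triE) => uv vx /allP tE.
rewrite (eq_bigr (fun A => H (size A) * (all (mem A) (tri_edges u v x))%:R)) => [|A _]; last first.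
  by rewrite /is_tri uv vx.
rewrite sum_subseqs_containing ?tri_edges_uniq // -/s.
have K0 : K != 0.
  by have := @kappa_gt0 M s d 0 M3 s3; rewrite kappa_tail // addn0 => /lt0r_neq0.
rewrite -[RHS](divff K0) {2}/K mulr_suml; apply: eq_bigr => m _.
rewrite /H /= -(@psi3_bin s m) //.
by ring.
Qed.

(** * Exactness before the graph reaches M+1 edges *)

(** The sum s + d grows only at an insertion with d = 0, where it equals the edge count and so
    cannot pass [M]. The sample undergoes the same list operations as the graph, so the two agree in
    order too. *)
Lemma dist_small M str t : valid_stream str ->
  (forall t', (t' <= t)%N -> size (graph_at str t') != M.+1) ->
  (size (graph_at str t) + pending str t <= M)%N /\
  forall p st, (p, st) \in dist M str t -> p != 0 ->
    st = (graph_at str t, pending str t, 0%N).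
Proof.
move=> Hv; elim: t => [|t IHt] small.
  by split=> // p st; rewrite /= inE => /eqP[_ ->].
have [|leM IH] := IHt; first by move=> t' lt; apply: small; apply: leqW.
have nM := small t.+1 (leqnn _); case: (Hv t) => _ eE.
split.
  move: leM nM eE; rewrite /= /apply_op; case: (str t).1.
    by rewrite size_rcons; lia.
  move=> le _ eE; rewrite size_rem // addnS -addSn prednK //.
  by case: (graph_at str t) eE.
move=> p st /flattenP[l /mapP[[q st'] qst ->]] /mapP[[r st''] rst [-> ->]].
rewrite mulf_eq0 negb_or => /andP[q0 r0].
move: rst; rewrite (IH _ _ qst q0) /= /step /samp /d_in /d_out /= addn0 /apply_op.
move: leM nM eE; rewrite /= /apply_op.
case: (str t).1 => leM nM eE; last by rewrite eE inE => /eqP[_ ->].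
have [d0|d0] := posnP (pending str t).
  rewrite d0 addn0 in leM *; rewrite size_rcons eqSS in nM.
  by rewrite /= ltn_neqAle nM leM inE => /eqP[_ ->].
(* Since d_o = 0, the branch that skips the edge has probability 0. *)
rewrite !inE => /orP[/eqP[_ ->] //|/eqP[r_eq _]].
by rewrite r_eq /= mul0r eqxx in r0.
Qed.

(** With [w] equal to s + d, only size [s] has positive weight, so [kappa] and [psi3] are both 1. *)
Lemma rho_full M s d (E : seq edge) : size E = s -> (3 <= M)%N -> (s + d <= M)%N ->
  rho M s (E, d, 0%N) = (tri_count E)%:R.
Proof.
move=> sE M3 leM; rewrite /rho /= sE; case: ltnP => [s3|s3].
  by rewrite tri_count_small ?sE.
have psi1 : psi3 s s = 1.
  have := @psi3_bin s (s - 3) s3; rewrite subnKC // !binn mul1r; exact.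
rewrite psi1 mulr1 kappa_tail // addn0 (minn_idPr leM).
rewrite big_ord_recr /= subnKC // big1 => [|i _].
  by rewrite add0r binn mul1r /hyper leq_addr addKn !binn divr1.
rewrite /d_in /hyper /=; case: ifP => _; last by rewrite mul0r mulr0.
by rewrite (@bin_small d) ?mul0r ?mulr0 //; have := ltn_ord i; lia.
Qed.

Lemma size_graph_le str t : (size (graph_at str t) <= t)%N.
Proof.
elim: t => //= t IHt; rewrite /apply_op; case: ifP => _; first by rewrite size_rcons.
by apply: leq_trans (leqW IHt); rewrite size_subseq ?rem_subseq.
Qed.

Theorem theorem4p16 (M : nat) (str : nat -> op) :
  (6 <= M)%N -> valid_stream str ->
  (forall t : nat, (1 <= t)%N ->
     (forall t' : nat, (M.+1 <= t' <= t)%N -> size (graph_at str t') != M.+1) ->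
     forall (p : rat) (st : state), (p, st) \in dist M str t -> 0 < p ->
       rho M (size (graph_at str t)) st = (tri_count (graph_at str t))%:R)
  /\
  (forall t : nat,
     (exists t' : nat, (M.+1 <= t' <= t)%N /\ size (graph_at str t') = M.+1) ->
     \sum_(x <- dist M str t) x.1 * rho M (size (graph_at str t)) x.2
       = (tri_count (graph_at str t))%:R).
Proof.
move=> M6 Hv; have M3 : (3 <= M)%N by apply: leq_trans M6.
split=> [t _ small p st in_dist p_gt0 | t _]; last exact: expected_rho.
have [|leM supp] := @dist_small M str t Hv.
  (* Before time M+1 the graph has at most [M] edges, since each step adds at most one. *)
  move=> t' le_t; case: (leqP M.+1 t') => [leM|ltM]; first by rewrite small ?leM.
  by rewrite neq_ltn ltnS (leq_trans (size_graph_le _ _)).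
by rewrite (supp p st in_dist) ?gt_eqF // rho_full.
Qed.
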